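(* Let $\mathbf P,\mathbf Q$ be probability measures on the subsets of $\mathcal N_o$ such that $$\mathbf P[N(o)\cap A\neq\emptyset]<\mathbf Q[N(o)\cap A\neq\emptyset]\qquad\text{for all }\emptyset\subsetneq A\subsetneq\mathcal N_o,$$ and assume $\mathbb Q[o\rightsquigarrow\infty]=0$. Then there is a constant $c>0$ such that $\mathbb P[o\rightsquigarrow\partial B_n]\le e^{-cn}$ for all $n\in\mathbb N$.
   Context: Work on $\mathbb Z^d$, $d\ge1$, with origin $o$. For $u\in\mathbb Z^d$ let $\mathcal N_u=\{v:\|u-v\|_1=1\}$. For a probability measure $\mathbf P$ on the subsets of $\mathcal N_o$, $N(o)$ denotes a random subset with law $\mathbf P$. The product measure $\mathbb P$ (resp. $\mathbb Q$) is the law of independent $(N(u))_{u\in\mathbb Z^d}$, $N(u)\subseteq\mathcal N_u$, with $\{x-u:x\in N(u)\}\sim\mathbf P$ (resp. $\mathbf Q$). Consider the directed graph with edges $(u,v)$, $v\in N(u)$. $B_n=\{x:\|x\|_1\le n\}$, $\partial B_n=B_{n+1}\setminus B_n$. $\{o\rightsquigarrow\partial B_n\}$ is the event that a directed path from $o$ reaches $\partial B_n$; $\{o\rightsquigarrow\infty\}$ is the event that the set of vertices reachable from $o$ by directed paths is infinite. *)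

(* Defs.v *)
From HB Require Import structures.
From mathcomp Require Import all_boot all_order all_algebra.
From mathcomp Require Import all_classical all_reals all_analysis.
Set Implicit Arguments. Unset Strict Implicit. Unset Printing Implicit Defensive.
Import Order.TTheory GRing.Theory Num.Theory.
Local Open Scope classical_set_scope.
Local Open Scope ring_scope.

Definition site (d : nat) := 'rV[int]_d.

(* A direction (i, b): unit step in coordinate i, positive if b. The set
   N_o of neighbours of the origin is in bijection with directions. *)
Definition Dir (d : nat) := ('I_d * bool)%type.

Definition step (d : nat) (x : site d) (v : Dir d) : site d :=
  \row_j (x ord0 j + (if j == v.1 then (if v.2 then 1 else -1) else 0)).

Definition norm1 (d : nat) (x : site d) : nat := (\sum_(j < d) `|x ord0 j|)%N.

(* A configuration assigns to each site u the set N(u) (as directions,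
   i.e. N(u) - u, a subset of N_o). *)
Definition config (d : nat) := site d -> {set Dir d}.

Inductive reach (d : nat) (w : config d) : site d -> site d -> Prop :=
| reach_refl x : reach w x x
| reach_step x v y : v \in w x -> reach w (step x v) y -> reach w x y.

(* {o ~> dB_n}, with dB_n = B_{n+1} \ B_n = {x : ||x||_1 = n+1} *)
Definition reaches_boundary (d : nat) (w : config d) (n : nat) : Prop :=
  exists y, reach w 0 y /\ norm1 y = n.+1.

Definition reaches_infinity (d : nat) (w : config d) : Prop :=
  ~ finite_set [set y | reach w 0 y].

Definition is_law (R : realType) (d : nat) (p : {ffun {set Dir d} -> R}) : Prop :=
  (forall S, 0 <= p S) /\ \sum_S p S = 1.

Definition hit_prob (R : realType) (d : nat) (p : {ffun {set Dir d} -> R})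
  (A : {set Dir d}) : R := \sum_(S | S :&: A != finset.set0) p S.

Definition iid_field (R : realType) (d : nat) (dT : measure_display)
  (T : measurableType dT) (P : probability T R)
  (N : site d -> T -> {set Dir d}) (p : {ffun {set Dir d} -> R}) : Prop :=
  (forall u S, measurable [set w | N u w = S]) /\
  (forall (s : seq (site d)) (S : site d -> {set Dir d}), uniq s ->
     P [set w | forall u, u \in s -> N u w = S u] = (\prod_(u <- s) p (S u))%:E).

(* Main.v *)
(** Explore the cluster of the origin site by site. Under the law [s]
    conditioned not to reach the sphere of radius k + m, a newly explored site
    still has hitting probabilities at least 1 - 2d theta_m times those of [s],
    theta_m being the probability to connect to distance m; so if [r] lies below [s] by that much, then
      theta_k(r) <= P_s(reach distance k | do not reach distance k + m).
    Hence theta_(k+m)(r) <= (2/3) theta_k(s) if theta_k(s) <= 1/2. Along the interpolation from [q]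
    to [p] this is iterated at scales growing geometrically with a summable loss
    of parameter, which gives polynomial decay of any order at [p], and then
    exponential decay by a finite-size criterion. Only the
    hitting probabilities of proper subsets of the neighbours matter, since the
    neighbour from which a site is discovered does not itself lead to the target. *)

Require Import Defs.
From HB Require Import structures.
From mathcomp Require Import all_boot all_order all_algebra.
From mathcomp Require Import all_classical all_reals all_analysis.
From mathcomp Require Import zify ring lra.
Import Order.TTheory GRing.Theory Num.Theory.
Local Open Scope classical_set_scope.
Local Open Scope ring_scope.

Set Implicit Arguments. Unset Strict Implicit. Unset Printing Implicit Defensive.

(** * Finite-volume expectations and step-by-step exploration of the cluster *)

Section Exploration.
Context {R : realType} {d : nat}.
Implicit Types (s : {ffun {set Dir d} -> R}) (W : seq (site d)) (w : config d).
Implicit Types (F G T : set (site d)) (S : {set Dir d}) (u x y : site d).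

Definition upd w u S : config d := fun x => if x == u then S else w x.

Lemma updC w u v S S' : u != v ->
  upd (upd w u S) v S' = upd (upd w v S') u S.
Proof.
move=> uv; apply/funext => x; rewrite /upd.
case: (eqVneq x v) => [->|//]; case: (eqVneq v u) => [vu|//].
by rewrite vu eqxx in uv.
Qed.

(* Independent sites of law [s] on W, and the fixed configuration [w] off W. *)
Fixpoint Ex s W w (g : config d -> R) : R :=
  if W is u :: W' then \sum_S s S * Ex s W' (upd w u S) g else g w.

(** Finite sums commute, so any site of [W] may be revealed first; this lets the exploration choose
    its next site. *)
Lemma Ex_rem s W w g u : u \in W ->
  Ex s W w g = \sum_S s S * Ex s (rem u W) (upd w u S) g.
Proof.
elim: W w => //= a W IH w; rewrite inE; case: (eqVneq u a) => [->|ua] //=.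
move=> uW.
under eq_bigr => S _ do rewrite (IH _ uW) mulr_sumr.
rewrite exchange_big; apply: eq_bigr => S _ /=.
rewrite mulr_sumr; apply: eq_bigr => S' _.
by rewrite mulrCA updC // eq_sym.
Qed.

Lemma Ex_comp s W w g u S : u \notin W ->
  Ex s W (upd w u S) g = Ex s W w (fun w' => g (upd w' u S)).
Proof.
elim: W w => //= a W IH w; rewrite inE negb_or => /andP[ua uW].
by apply: eq_bigr => S' _; rewrite updC // IH.
Qed.

Lemma Ex_sum s W w (I : finType) (c : I -> R) (g : I -> config d -> R) :
  Ex s W w (fun w' => \sum_i c i * g i w') = \sum_i c i * Ex s W w (g i).
Proof.
elim: W w => //= a W IH w.
under eq_bigr => S _ do rewrite IH mulr_sumr.
rewrite exchange_big; apply: eq_bigr => i _ /=.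
by rewrite mulr_sumr; apply: eq_bigr => S _; rewrite mulrCA.
Qed.

Lemma eq_Ex s W w g g' : g =1 g' -> Ex s W w g = Ex s W w g'.
Proof. by move=> /funext ->. Qed.

Lemma le_Ex s W w g g' : is_law s -> (forall w', g w' <= g' w') ->
  Ex s W w g <= Ex s W w g'.
Proof.
move=> [s0 _] gg'; elim: W w => //= a W IH w.
by apply: ler_sum => S _; rewrite ler_wpM2l.
Qed.

Lemma Ex_cst s W w c : is_law s -> Ex s W w (fun=> c) = c.
Proof.
move=> [_ s1]; elim: W w => //= a W IH w.
by under eq_bigr => S _ do rewrite IH; rewrite -mulr_suml s1 mul1r.
Qed.

Definition hits w F T : Prop := exists x y, [/\ F x, T y & reach w x y].

Definition out u S : set (site d) := [set y | exists2 v, v \in S & y = step u v].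

Definition none : config d := fun=> finset.set0.

(** Off [W] all out-sets are empty: an explored site has already passed its out-neighbours on to
    [F], and sites outside the box are cut off. *)
Definition phit s W F T : R := Ex s W none (fun w => `[< hits w F T >]%:R).

Lemma reach_sub w w' x y : (forall z, w z \subset w' z) ->
  reach w x y -> reach w' x y.
Proof.
move=> ww'; elim=> [z|z v t vz _ IH]; first exact: reach_refl.
by apply: reach_step IH; apply: (fintype.subsetP (ww' _)).
Qed.

(** After its last visit to [u] a path no longer uses N(u), so [u] can be closed once its
    out-neighbours are sources. *)
Lemma hits_upd w u S F T : F u ->
  hits (upd w u S) F T <-> hits (upd w u finset.set0) (F `|` out u S) T.
Proof.
move=> Fu; split=> [[x [y [Fx Ty xy]]]|[x [y [Fx Ty xy]]]].
(* The induction runs along the path, whose later vertices need not lie in [F]; the current start is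
   therefore added to the sources. *)
- suff [t [z [tx Tz tz]]] :
      hits (upd w u finset.set0) ([set x] `|` (F `|` out u S)) T.
    exists t, z; split=> //; case: tx => [->|//]; by left.
  elim: xy Ty {Fx} => [z|z v t vz _ IH] Tt.
    by exists z, z; split=> //; [left|exact: reach_refl].
  have [a [b [ab Tb rab]]] := IH Tt.
  move: vz; rewrite /upd; case: (eqVneq z u) => [zu|zu] vz.
    exists a, b; split=> //; right.
    by case: ab => // ->; right; exists v; rewrite ?zu.
  case: ab => [abE|ab]; last by exists a, b; split => //; right.
  exists z, b; split => //; first by left.
  apply: (@reach_step _ _ _ v); first by rewrite /upd (negbTE zu).
  by rewrite -abE.
- have {}xy : reach (upd w u S) x y.
    apply: reach_sub xy => z; rewrite /upd; case: eqP => // _; exact: finset.sub0set.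
  case: Fx => [Fx|[v vS xE]]; first by exists x, y.
  exists u, y; split=> //; apply: (@reach_step _ _ _ v); first by rewrite /upd eqxx.
  by rewrite -xE.
Qed.

Lemma upd_none u : upd none u finset.set0 = none.
Proof. by apply/funext => x; rewrite /upd /none; case: eqP. Qed.

(* Domain Markov property of the exploration: revealing N(u) replaces the
   pair (unexplored sites, reached set) by (W \ u, F U N(u)). *)
Lemma phit_step s W F T u : uniq W -> u \in W -> F u ->
  phit s W F T = \sum_S s S * phit s (rem u W) (F `|` out u S) T.
Proof.
move=> uW Wu Fu; rewrite /phit (Ex_rem _ _ _ Wu); apply: eq_bigr => S _.
have nu : u \notin rem u W by rewrite mem_rem_uniqF.
congr (_ * _); rewrite Ex_comp // -[in RHS](upd_none u) [RHS]Ex_comp //.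
apply: eq_Ex => w; congr (nat_of_bool _)%:R; apply: asbool_equiv_eq.
exact: hits_upd.
Qed.

Lemma phit_hit s W F T x : is_law s -> F x -> T x -> phit s W F T = 1.
Proof.
move=> sl Fx Tx; rewrite -[RHS](@Ex_cst s W none 1 sl); apply: eq_Ex => w.
by rewrite asboolT //; exists x, x; split => //; exact: reach_refl.
Qed.

Lemma phit_ge0 s W F T : is_law s -> 0 <= phit s W F T.
Proof.
move=> sl; rewrite -[leLHS](@Ex_cst s W none 0 sl).
by apply: le_Ex => // w; rewrite ler0n.
Qed.

Lemma phit_le1 s W F T : is_law s -> phit s W F T <= 1.
Proof.
move=> sl; rewrite -[leRHS](@Ex_cst s W none 1 sl).
by apply: le_Ex => // w; rewrite lern1 leq_b1.
Qed.

Lemma Ex_supp s W w g g' :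
  (forall w', (forall x, x \notin W -> w' x = w x) -> g w' = g' w') ->
  Ex s W w g = Ex s W w g'.
Proof.
elim: W w => [|a W IH] w /= H; first by apply: H.
apply: eq_bigr => S _; congr (_ * _); apply: IH => w' Hw'; apply: H => x.
rewrite inE negb_or => /andP[xa xW]; rewrite Hw' // /upd (negbTE xa) //.
Qed.

Lemma reach_stuck w x y : w x = finset.set0 -> reach w x y -> y = x.
Proof.
move=> wx xy; case: xy wx => [//|z v t vz _] z0.
by rewrite z0 finset.in_set0 in vz.
Qed.

Lemma phit_stuck s W F G T : is_law s -> (forall x, F x -> x \notin W) ->
  (forall x, F x -> ~ T x) -> phit s W (F `|` G) T = phit s W G T.
Proof.
move=> sl FW FT; apply: Ex_supp => w Hw; congr (nat_of_bool _)%:R.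
apply: asbool_equiv_eq; split=> [[x [y [Fx Ty xy]]]|[x [y [Gx Ty xy]]]].
  case: Fx => Fx; last by exists x, y.
  have yx := reach_stuck (Hw _ (FW _ Fx)) xy.
  by case: (FT _ Fx); rewrite -yx.
by exists x, y; split => //; right.
Qed.

Lemma phit_set0 s W T : is_law s -> phit s W set0 T = 0.
Proof.
move=> sl; rewrite -[RHS](@Ex_cst s W none 0 sl); apply: eq_Ex => w.
by rewrite asboolF // => -[x [y [//]]].
Qed.

Lemma phit_eq0 s W F T : is_law s -> (forall x, F x -> x \notin W) ->
  (forall x, F x -> ~ T x) -> phit s W F T = 0.
Proof.
by move=> sl FW FT; rewrite -(@phit_set0 s W T sl) -(@phit_stuck s W F set0) // setU0.
Qed.

Lemma phit_mono s W F G T : is_law s -> F `<=` G -> phit s W F T <= phit s W G T.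
Proof.
move=> sl FG; apply: le_Ex => // w; rewrite ler_nat.
have [/asboolP[x [y [Fx Ty xy]]]|] := boolP `[< hits w F T >]; last by [].
by rewrite asboolT //; exists x, y; split => //; exact: FG.
Qed.

Lemma phit_union s W (I : finType) (P : pred I) (F : I -> set (site d)) G T :
  is_law s -> (forall x, G x -> exists2 i, P i & F i x) ->
  phit s W G T <= \sum_(i | P i) phit s W (F i) T.
Proof.
move=> sl GF; rewrite big_mkcond /=.
have -> : \sum_i (if P i then phit s W (F i) T else 0) =
    \sum_i (P i)%:R * phit s W (F i) T.
  by apply: eq_bigr => i _; case: (P i); rewrite ?mul1r ?mul0r.
rewrite /phit -Ex_sum; apply: le_Ex => // w.
have [/asboolP[x [y [Gx Ty xy]]]|] := boolP `[< hits w G T >]; last first.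
  by move=> _; apply: sumr_ge0 => i _; rewrite mulr_ge0 // ler0n.
have [i Pi Fx] := GF _ Gx.
rewrite (bigD1 i) //= Pi mul1r asboolT; last by exists x, y.
by rewrite lerDl; apply: sumr_ge0 => j _; rewrite mulr_ge0 // ler0n.
Qed.

Lemma phit_target0 s W F : is_law s -> phit s W F set0 = 0.
Proof.
move=> sl; rewrite -[RHS](@Ex_cst s W none 0 sl); apply: eq_Ex => w.
by rewrite asboolF // => -[x [y []]].
Qed.

End Exploration.

(** * Comparison of explorations in different boxes and under different laws *)

Section Comparison.
Context {R : realType} {d : nat}.
Implicit Types (r s : {ffun {set Dir d} -> R}) (W : seq (site d)) (w : config d).
Implicit Types (F G T : set (site d)) (S : {set Dir d}) (u x y : site d).

Lemma stepB x v c : step x v - c = step (x - c) v :> site d.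
Proof. by apply/rowP => j; rewrite !mxE addrAC. Qed.

Lemma norm1_step x v : (norm1 (step x v) <= (norm1 x).+1)%N.
Proof.
rewrite /norm1 (bigD1 v.1) //= [in leqRHS](bigD1 v.1) //= -addSn leq_add //.
  by rewrite mxE eqxx; case: v.2 => /=; lia.
apply: leq_sum => j jv; rewrite mxE (negbTE jv) addr0 //.
Qed.

Lemma step_back x v : step (step x v) (v.1, ~~ v.2) = x.
Proof.
apply/rowP => j; rewrite !mxE /=; case: eqP => _; last by rewrite !addr0.
by case: v.2; rewrite /= ?addrK ?subrK.
Qed.

Lemma norm1_0 : norm1 (0 : site d) = 0%N.
Proof. by rewrite /norm1 big1 // => j _; rewrite mxE. Qed.

Lemma norm1_le_sub x c : (norm1 x <= norm1 (x - c)%R + norm1 c)%N.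
Proof.
have tri (a b : int) : (`|a| <= `|a - b| + `|b|)%N by lia.
by rewrite /norm1 -big_split /=; apply: leq_sum => j _; rewrite !mxE.
Qed.

Definition sph (m : nat) : set (site d) := [set y | norm1 y = m].

(** The case split that drives the inductions: the target is attained, a reached site is still
    unexplored, or the exploration has died out. *)
Lemma frontier_cases W F T :
  [\/ exists2 x, F x & T x,
      (forall x, F x -> ~ T x) /\ (exists2 u, u \in W & F u) |
      (forall x, F x -> ~ T x) /\ (forall x, F x -> x \notin W) ].
Proof.
case: (pselect (exists2 x, F x & T x)) => [h|h]; first exact: Or31.
have FT x : F x -> ~ T x by move=> Fx Tx; apply: h; exists x.
case: (pselect (exists2 u, u \in W & F u)) => [k|k]; first exact: Or32.
by apply: Or33; split=> // x Fx; apply/negP => xW; apply: k; exists x.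
Qed.

(** Coupling of two explorations: when the first reveals [a], the second reveals [a - c] with the
    same outcome. This covers both translation invariance and changes of the box. *)
Lemma phit_transfer s m c W1 W2 F1 F2 T : is_law s -> uniq W1 -> uniq W2 ->
  (forall z, z \in W1 -> (norm1 (z - c)%R < m)%N -> z - c \in W2) ->
  (forall z, F1 z -> (norm1 (z - c)%R <= m)%N /\ F2 (z - c)) ->
  (forall z, T z -> (m <= norm1 (z - c)%R)%N) ->
  phit s W1 F1 T <= phit s W2 F2 (sph m).
Proof.
move=> sl; have [n] := ubnP (size W1).
elim: n W1 W2 F1 F2 => // n IH W1 W2 F1 F2 sW uW1 uW2 HW HF HT.
have [[x F2x Tx]|[noF [u uW F2u]]|[noF noW]] := frontier_cases W2 F2 (sph m).
- by rewrite (phit_hit _ _ F2x Tx) // phit_le1.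
- case: (pselect (exists2 u, u \in W1 & F1 u)) => [[a aW F1a]|k]; last first.
    rewrite [leLHS]phit_eq0 ?phit_ge0 // => z F1z.
      by apply/negP => zW; apply: k; exists z.
    move=> Tz; have [zm F2z] := HF _ F1z.
    by apply: (noF _ F2z); apply/eqP; rewrite eqn_leq zm HT.
  have [am F2a] := HF _ F1a.
  have alt : (norm1 (a - c)%R < m)%N.
    by rewrite ltn_neqAle am andbT; apply/eqP => am'; exact: (noF _ F2a).
  rewrite (@phit_step _ _ s W1 F1 T a) // (@phit_step _ _ s W2 F2 _ (a - c)) ?HW //.
  apply: ler_sum => S _; apply: ler_wpM2l; first by case: sl.
  apply: IH => //; rewrite ?rem_uniq ?size_rem //.
  + by move: sW aW; case: (W1).
  + move=> z; rewrite !mem_rem_uniq // !inE => /andP[za zW] zm.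
    by rewrite (inj_eq (addIr _)) za HW.
  + move=> z [F1z|[v vS ->]].
      by have [? ?] := HF _ F1z; split=> //; left.
    rewrite stepB; split; first exact: leq_trans (norm1_step _ _) _.
    by right; exists v.
- rewrite [leLHS]phit_eq0 ?phit_ge0 // => z F1z.
    have [zm F2z] := HF _ F1z; apply/negP => zW.
    move: zm; rewrite leq_eqVlt => /orP[/eqP zm|zm]; first exact: (noF _ F2z).
    by have := noW _ F2z; rewrite HW.
  move=> Tz; have [zm F2z] := HF _ F1z.
  by apply: (noF _ F2z); apply/eqP; rewrite eqn_leq zm HT.
Qed.

Lemma compl_sum s (f : {set Dir d} -> R) : is_law s ->
  1 - \sum_S s S * f S = \sum_S s S * (1 - f S).
Proof.
move=> [_ s1]; rewrite -[X in X - _]s1 -sumrB.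
by apply: eq_bigr => S _; rewrite mulrBr mulr1.
Qed.

(* A substitute for the Harris inequality, which fails for general laws: once
   the cluster of F is revealed, the target can only be hit from G off it. *)
Lemma compl_phit_union s W F G T (e : R) : is_law s -> uniq W ->
  (forall W', uniq W' -> phit s W' G T <= e) ->
  (1 - phit s W F T) * (1 - e) <= 1 - phit s W (F `|` G) T.
Proof.
move=> sl uW He; have [n] := ubnP (size W).
elim: n W uW F => // n IH W uW F sW.
have [[x Fx Tx]|[noF [u Wu Fu]]|[noF noW]] := frontier_cases W F T.
- by rewrite !(@phit_hit _ _ _ _ _ _ x) ?subrr ?mul0r //; left.
- rewrite !(@phit_step _ _ _ _ _ _ u) //; last by left.
  rewrite !compl_sum // mulr_suml; apply: ler_sum => S _.
  rewrite -mulrA ler_wpM2l //; first by case: sl.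
  rewrite setUAC; apply: IH; rewrite ?rem_uniq ?size_rem //.
  by move: sW Wu; case: (W).
- by rewrite [in leLHS]phit_eq0 // phit_stuck // subr0 mul1r lerB // He.
Qed.

Lemma hit_probE s (A : {set Dir d}) :
  hit_prob s A = \sum_S s S * (S :&: A != finset.set0)%:R.
Proof.
rewrite /hit_prob big_mkcond /=; apply: eq_bigr => S _.
by case: ifP => _; rewrite ?mulr1 ?mulr0.
Qed.

(** The weights [f S] are constant up to a factor [1 - e], so biasing [s] by them costs at most this
    factor, which the gap between [r] and [s] pays for. *)
Lemma hit_compare r s (e h : R) (f : {set Dir d} -> R) (A : {set Dir d}) :
  is_law r -> is_law s -> 0 <= h ->
  (A != finset.set0 -> hit_prob r A <= (1 - e) * hit_prob s A) ->
  (forall S, h * (1 - e) <= f S <= h) ->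
  (\sum_S s S * f S) * hit_prob r A
    <= \sum_S s S * f S * (S :&: A != finset.set0)%:R.
Proof.
move=> rl sl h0 HA Hf.
have [->|A0] := eqVneq A finset.set0.
  rewrite (_ : hit_prob r _ = 0); last first.
    by rewrite hit_probE big1 // => S _; rewrite finset.setI0 eqxx mulr0.
  by rewrite mulr0 big1 // => S _; rewrite finset.setI0 eqxx mulr0.
have r0 : 0 <= hit_prob r A by apply: sumr_ge0 => S _; case: rl.
have Hh : \sum_S s S * f S <= h.
  rewrite -[leRHS]mul1r; case: sl => s0 <-; rewrite mulr_suml.
  by apply: ler_sum => S _; rewrite ler_wpM2l //; case/andP: (Hf S).
apply: (@le_trans _ _ (h * ((1 - e) * hit_prob s A))).
  by apply: (le_trans (ler_wpM2r r0 Hh)); rewrite ler_wpM2l // HA.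
rewrite hit_probE mulrA mulr_sumr; apply: ler_sum => S _.
rewrite mulrA ler_wpM2r ?ler0n // mulrC ler_wpM2l //; first by case: sl.
by case/andP: (Hf S).
Qed.

(* For T beyond the sphere of radius k this says that, given that F does not
   reach T under s, it is still at least as likely to reach that sphere as it
   is under r. The hypothesis that every u in F has a neighbour in F keeps the
   unconstrained case A = N_o from occurring. *)
Lemma phit_compare r s (e : R) (k : nat) W F T : is_law r -> is_law s ->
  (forall A : {set Dir d}, A != finset.set0 -> A != [set: Dir d]%SET ->
     hit_prob r A <= (1 - e) * hit_prob s A) ->
  (forall z, T z -> (k <= norm1 z)%N) ->
  (forall W' u S, uniq W' -> (norm1 u < k)%N -> phit s W' (out u S) T <= e) ->
  uniq W -> (forall x, F x -> (norm1 x <= k)%N) ->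
  (forall u, u \in W -> F u -> exists v, F (step u v)) ->
  phit r W F (sph k) * (1 - phit s W F T) <= phit s W F (sph k) - phit s W F T.
Proof.
move=> rl sl Hhit HT He uW; have [n] := ubnP (size W).
elim: n W uW F => // n IH W uW F sW Fk Fnb.
have [[x Fx Tx]|[noF [u Wu Fu]]|[noF noW]] := frontier_cases W F (sph k).
- by rewrite !(@phit_hit _ _ _ _ _ (sph k) x) // mul1r.
- have uk : (norm1 u < k)%N.
    by rewrite ltn_neqAle Fk // andbT; apply/eqP => uk; exact: (noF _ Fu).
  rewrite !(@phit_step _ _ _ W _ _ u) // compl_sum // -sumrB.
  set W' := rem u W; pose c S := phit s W' (F `|` out u S) T.
  pose b S := phit r W' (F `|` out u S) (sph k).
  have uW' : uniq W' by rewrite rem_uniq.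
  (* The induction hypothesis is averaged over [S]; what remains is to compare the law [r] of N(u)
     with [s] biased by [1 - c S]. *)
  apply: (@le_trans _ _ (\sum_S s S * (1 - c S) * b S)); last first.
    apply: ler_sum => S _; rewrite -mulrA -mulrBr ler_wpM2l //; first by case: sl.
    rewrite mulrC; apply: IH => //.
    + rewrite size_rem //; by move: sW Wu; case: (W).
    + by move=> x [/Fk//|[v _ ->]]; exact: leq_trans (norm1_step _ _) _.
    + move=> x xW' [Fx|[v _ ->]].
        have [v Fv] := Fnb x (mem_rem xW') Fx; by exists v; left.
      by exists (v.1, ~~ v.2); rewrite step_back; left.
  rewrite mulrC mulr_sumr.
  under eq_bigr => S _ do rewrite mulrA -/(b S) -/(c S).
  rewrite -subr_ge0 -sumrB.
  set H := \sum_S s S * (1 - c S).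
  under eq_bigr => S _ do rewrite -mulrBl /b /phit.
  (* The other sites have law [r] on both sides, so it is enough to compare the sums over [S] for a
     fixed [w]. *)
  rewrite -Ex_sum -[leLHS](@Ex_cst _ _ r W' none 0 rl); apply: le_Ex => // w.
  under eq_bigr => S _ do rewrite mulrBl -(mulrA H).
  rewrite sumrB -mulr_sumr subr_ge0.
  have [/asboolP[x [y [Fx Ty xy]]]|/asboolP nB] := boolP `[< hits w F (sph k) >].
    have X1 S : `[< hits w (F `|` out u S) (sph k) >] = true.
      by apply: asboolT; exists x, y; split => //; left.
    under eq_bigr => S _ do rewrite X1 mulr1.
    under [leRHS]eq_bigr => S _ do rewrite X1 mulr1.
    by case: rl => _ ->; rewrite mulr1.
  (* Directions from [u] that lead to the sphere under [w]. As [F] itself does not hit it, [F]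
     together with N(u) = [S] hits exactly when [S] meets [A]. *)
  pose A : {set Dir d} := [set v | `[< hits w [set step u v] (sph k) >]]%SET.
  have XA S : `[< hits w (F `|` out u S) (sph k) >] = (S :&: A != finset.set0).
    apply/asboolP/finset.set0Pn => [[x [y [[Fx|[v vS xE]] Ty xy]]]|[v]].
    + by case: nB; exists x, y.
    + exists v; rewrite !inE vS; apply/asboolP; by exists x, y.
    + rewrite !inE => /andP[vS /asboolP[x [y [-> Ty xy]]]].
      by exists (step u v), y; split => //; right; exists v.
  under eq_bigr => S _ do rewrite XA.
  under [leRHS]eq_bigr => S _ do rewrite XA.
  rewrite -hit_probE; apply: (@hit_compare r s e (1 - phit s W' F T)) => //.
  + by rewrite subr_ge0 phit_le1.
  (* If [A] contained all directions, the neighbour of [u] in [F] would itself lead to the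
     sphere. *)
  + move=> A0; apply: Hhit => //; apply/negP => /eqP AT.
    have [v Fv] := Fnb _ Wu Fu.
    have : v \in A by rewrite AT inE.
    rewrite inE => /asboolP[x [y [-> Ty xy]]].
    by apply: nB; exists (step u v), y.
  + move=> S; rewrite compl_phit_union //=; last by move=> W'' uW''; exact: He.
    by rewrite lerB // phit_mono // => x; left.
- rewrite !(@phit_eq0 _ _ _ W F) ?mul0r ?subrr // => x Fx Tx.
  apply: (noF _ Fx); apply/eqP; rewrite eqn_leq Fk // HT //.
Qed.

End Comparison.

(** * Connection probabilities in balls *)

Section Balls.
Context {R : realType} {d : nat}.
Implicit Types (r s : {ffun {set Dir d} -> R}) (W : seq (site d)).
Implicit Types (F G T : set (site d)) (S : {set Dir d}) (u x y : site d).

(** A list, since [Ex] recurses on one; finite functions, shifted by [n], enumerate the enclosing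
    cube and also give the size bound. *)
Definition l1ball (n : nat) : seq (site d) :=
  [seq x <- undup (codom (fun f : {ffun 'I_d -> 'I_(n.*2.+1)} =>
     \row_j ((f j : nat)%:Z - n%:Z))) | (norm1 x <= n)%N].

Lemma l1ball_uniq n : uniq (l1ball n).
Proof. by rewrite filter_uniq // undup_uniq. Qed.

Lemma mem_l1ball n x : (x \in l1ball n) = (norm1 x <= n)%N.
Proof.
rewrite mem_filter mem_undup; case: leqP => //= xn; apply/codomP.
have xj j : (`|x ord0 j| <= n)%N.
  by apply: leq_trans xn; rewrite /norm1 (bigD1 j) //= leq_addr.
exists [ffun j => inord `|(x ord0 j + n%:Z)%R|%N].
apply/rowP => j; rewrite mxE ffunE inordK; have := xj j; last lia.
move: (x ord0 j) => a; lia.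
Qed.

Lemma size_l1ball n : (size (l1ball n) <= n.*2.+1 ^ d)%N.
Proof.
rewrite size_filter (leq_trans (count_size _ _)) // (leq_trans (size_undup _)) //.
by rewrite size_codom card_ffun !card_ord.
Qed.

Definition theta s m := phit s (l1ball m) [set 0] (sph m).

(* tau is theta with N(0) replaced by the whole neighbourhood; every site
   reached but not yet explored then has a reached neighbour. *)
Definition near0 : set (site d) := [set 0] `|` out 0 [set: Dir d]%SET.

Definition tau s m := phit s (rem 0 (l1ball m)) near0 (sph m).

Lemma rem_l1ball_uniq n u : uniq (rem u (l1ball n)).
Proof. by rewrite rem_uniq // l1ball_uniq. Qed.

Lemma mem_rem_l1ball n u x : (x \in rem u (l1ball n)) = (x != u) && (norm1 x <= n)%N.
Proof. by rewrite mem_rem_uniq ?l1ball_uniq // !inE mem_l1ball. Qed.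

Lemma near0_norm x : near0 x -> (norm1 x <= 1)%N.
Proof.
move=> [->|[v _ ->]]; first by rewrite norm1_0.
by apply: leq_trans (norm1_step _ _) _; rewrite norm1_0.
Qed.

Lemma theta_le1 s m : is_law s -> theta s m <= 1.
Proof. exact: phit_le1. Qed.

Lemma theta_ge0 s m : is_law s -> 0 <= theta s m.
Proof. exact: phit_ge0. Qed.

Lemma tau_ge0 s m : is_law s -> 0 <= tau s m.
Proof. exact: phit_ge0. Qed.

Lemma theta_le_tau s m : is_law s -> theta s m <= tau s m.
Proof.
move=> sl; rewrite /theta (@phit_step _ _ _ _ _ _ 0) ?l1ball_uniq //; last first.
  by rewrite mem_l1ball norm1_0.
rewrite -[leRHS]mul1r; case: (sl) => s0 <-; rewrite mulr_suml.
apply: ler_sum => S _; rewrite ler_wpM2l //; apply: phit_mono => // x.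
by move=> [->|[v vS ->]]; [left|right; exists v => //; rewrite inE].
Qed.

Lemma phit_point_le_theta s W c m n : is_law s -> uniq W ->
  (norm1 c + m <= n)%N -> phit s W [set c] (sph n) <= theta s m.
Proof.
move=> sl uW cmn; apply: (@phit_transfer _ _ s m c) => //; first exact: l1ball_uniq.
- by move=> z _ zm; rewrite mem_l1ball ltnW.
- by move=> z ->; rewrite subrr norm1_0.
- by move=> z zn; have := norm1_le_sub z c; rewrite zn; lia.
Qed.

Lemma theta_anti s m n : is_law s -> (m <= n)%N -> theta s n <= theta s m.
Proof.
by move=> sl mn; rewrite {1}/theta; apply: phit_point_le_theta; rewrite ?l1ball_uniq ?norm1_0.
Qed.

Lemma tau_anti s m n : is_law s -> (0 < m <= n)%N -> tau s n <= tau s m.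
Proof.
move=> sl /andP[m0 mn]; apply: (@phit_transfer _ _ s m 0) => //; rewrite ?rem_l1ball_uniq //.
- by move=> z; rewrite !mem_rem_l1ball subr0 => /andP[-> _] /ltnW.
- by move=> z; rewrite subr0 => nz; split => //; rewrite (leq_trans (near0_norm nz)).
- by move=> z; rewrite subr0 /sph /= => ->.
Qed.

(** Union bound over the 2d + 1 points of [near0]: each has norm at most 1, hence distance at least
    [m] from the sphere. *)
Lemma tau_le_theta s m : is_law s -> tau s m.+1 <= #|{: Dir d}|.+1%:R * theta s m.
Proof.
move=> sl; pose f (i : option (Dir d)) : set (site d) :=
  if i is Some v then [set step 0 v] else [set 0].
apply: (@le_trans _ _ (\sum_(i : option (Dir d) | true)
    phit s (rem 0 (l1ball m.+1)) (f i) (sph m.+1))).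
  apply: phit_union => // x [->|[v _ ->]]; first by exists None.
  by exists (Some v).
rewrite -card_option mulr_natl -sumr_const; apply: ler_sum => i _.
case: i => [v|]; rewrite /f; apply: phit_point_le_theta => //;
  rewrite ?rem_l1ball_uniq ?norm1_0 //.
by have := norm1_step 0 v; rewrite norm1_0; lia.
Qed.

Lemma phit_out_le s W u S m k : is_law s -> uniq W -> (norm1 u < k)%N ->
  phit s W (out u S) (sph (k + m)) <= #|{: Dir d}|%:R * theta s m.
Proof.
move=> sl uW uk.
apply: (@le_trans _ _ (\sum_(v : Dir d | true)
    phit s W [set step u v] (sph (k + m)))).
  by apply: phit_union => // x [v _ ->]; exists v.
rewrite mulr_natl -sumr_const; apply: ler_sum => v _.
by apply: phit_point_le_theta => //; have := norm1_step u v; lia.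
Qed.

(** [phit_compare] with the sphere of radius [k + m] as target: neighbours of a site of norm below
    [k] are at distance at least [m] from it, whence e = 2d theta_m. *)
Lemma tau_compare r s k m : is_law r -> is_law s -> (0 < k)%N ->
  (forall A : {set Dir d}, A != finset.set0 -> A != [set: Dir d]%SET ->
     hit_prob r A <= (1 - #|{: Dir d}|%:R * theta s m) * hit_prob s A) ->
  tau r k * (1 - tau s (k + m)) <= tau s k - tau s (k + m).
Proof.
move=> rl sl k0 Hhit.
(* For reaching the sphere of radius [k], the boxes of radius [k + m] and [k] are equivalent. *)
have W_k t : is_law t -> phit t (rem 0 (l1ball (k + m))) near0 (sph k) = tau t k.
  move=> tl; apply/eqP; rewrite eq_le.
  by apply/andP; split; apply: (@phit_transfer _ _ t k 0) => //;
    rewrite ?rem_l1ball_uniq // => z; rewrite ?subr0 ?mem_rem_l1ball /sph /=;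
    (try by move=> ->); (try by move=> nz; split => //;
    rewrite (leq_trans (near0_norm nz))); move=> /andP[-> _] zk /=; lia.
rewrite -!W_k //; apply: (phit_compare rl sl Hhit); rewrite ?rem_l1ball_uniq //.
- by move=> z ->; rewrite leq_addr.
- by move=> W' u S uW uk; exact: phit_out_le.
- by move=> x nx; rewrite (leq_trans (near0_norm nx)).
- move=> u; rewrite mem_rem_l1ball => /andP[u0 _] [uE|[v _ ->]].
    by rewrite uE eqxx in u0.
  by exists (v.1, ~~ v.2); rewrite step_back; left.
Qed.

(** With an empty target and e = 0 the conditioning disappears, and [phit_compare] becomes
    monotonicity in the law. *)
Lemma le_tau r s k : is_law r -> is_law s -> (0 < k)%N ->
  (forall A : {set Dir d}, A != finset.set0 -> A != [set: Dir d]%SET ->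
     hit_prob r A <= hit_prob s A) ->
  tau r k <= tau s k.
Proof.
move=> rl sl k0 Hhit.
have := @phit_compare _ _ r s 0 k (rem 0 (l1ball k)) near0 set0 rl sl.
rewrite !phit_target0 // !subr0 mulr1; apply; rewrite ?rem_l1ball_uniq //.
- by move=> A A0 AT; rewrite mul1r Hhit.
- by move=> W' u S uW uk; rewrite phit_target0.
- by move=> x nx; rewrite (leq_trans (near0_norm nx)).
- move=> u; rewrite mem_rem_l1ball => /andP[u0 _] [uE|[v _ ->]].
    by rewrite uE eqxx in u0.
  by exists (v.1, ~~ v.2); rewrite step_back; left.
Qed.

Lemma tau_contract r s k m : is_law r -> is_law s -> (0 < k)%N ->
  (forall A : {set Dir d}, A != finset.set0 -> A != [set: Dir d]%SET ->
     hit_prob r A <= (1 - #|{: Dir d}|%:R * theta s m) * hit_prob s A) ->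
  tau s k <= 2^-1 -> tau r (k + m) <= 2 / 3 * tau s k.
Proof.
move=> rl sl k0 Hhit sk.
have := tau_compare rl sl k0 Hhit.
have rs : tau r (k + m) <= tau s (k + m).
  apply: le_tau => //; first by rewrite ltn_addr.
  move=> A A0 AT; apply: (le_trans (Hhit _ A0 AT)).
  rewrite ler_piMl //; first by apply: sumr_ge0 => S _; case: sl.
  by rewrite lerBlDr lerDl mulr_ge0 // theta_ge0.
have rk : tau r (k + m) <= tau r k by rewrite tau_anti // k0 leq_addr.
have sk' : tau s (k + m) <= tau s k by rewrite tau_anti // k0 leq_addr.
have := tau_ge0 (k + m) rl; have := tau_ge0 (k + m) sl.
(* From a <= x and x (1 - b) <= y - b follows a (1 - b) + b <= y; then a <= b gives a (2 - a) <= y,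
   and a <= 1/2 gives 3a/2 <= y. *)
move: (tau r (k + m)) (tau s (k + m)) (tau r k) (tau s k) rs rk sk' sk.
move=> a b x y; nra.
Qed.

(** Only sites of norm below [n] are explored first; afterwards each reached site on the sphere of
    radius [n] must start a connection over distance [a]. *)
Lemma phit_cut s W F n a : is_law s -> uniq W -> (forall x, F x -> (norm1 x <= n)%N) ->
  phit s W F (sph (n + a)) <= phit s W F (sph n) * ((size (l1ball n))%:R * theta s a).
Proof.
move=> sl uW; have [N] := ubnP (size W).
elim: N W uW F => // N IH W uW F sW Fn.
case: (pselect (exists u, [/\ u \in W, F u & (norm1 u < n)%N])) => [[u [Wu Fu un]]|noW].
  rewrite !(@phit_step _ _ _ _ _ _ u) // mulr_suml; apply: ler_sum => S _.
  rewrite -mulrA ler_wpM2l //; first by case: sl.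
  apply: IH; rewrite ?rem_uniq ?size_rem //; first by move: sW Wu; case: (W).
  by move=> x [/Fn//|[v _ ->]]; exact: leq_trans (norm1_step _ _) _.
case: (pselect (exists2 x, F x & norm1 x = n)) => [[x Fx xn]|noF]; last first.
  have Flt x : F x -> (norm1 x < n)%N.
    by move=> Fx; rewrite ltn_neqAle Fn // andbT; apply/eqP => xn; apply: noF; exists x.
  rewrite [leLHS]phit_eq0 ?mulr_ge0 ?phit_ge0 ?theta_ge0 // => x Fx.
    by apply/negP => xW; apply: noW; exists x; split => //; exact: Flt.
  by move=> xna; have := Flt _ Fx; rewrite xna; lia.
rewrite [X in X * _](@phit_hit _ _ _ _ _ _ x) // mul1r.
(* Sites strictly inside the sphere are explored and off the target, so only those on the sphere
   matter. *)
have -> : F = (F `&` [set y | (norm1 y < n)%N]) `|` (F `&` sph n).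
  apply/seteqP; split => y; last by move=> [[]|[]].
  move=> Fy; have := Fn _ Fy; rewrite leq_eqVlt => /orP[/eqP yn|yn].
    by right.
  by left.
rewrite phit_stuck //; last 2 first.
- by move=> y [Fy yn]; apply/negP => Wy; apply: noW; exists y.
- by move=> y [Fy /= yn] yna; move: yn; rewrite yna; lia.
apply: (@le_trans _ _ (\sum_(y : seq_sub (l1ball n) | true)
    phit s W [set val y] (sph (n + a)))).
  apply: phit_union => // y [_ yn].
  have yb : y \in l1ball n by rewrite mem_l1ball yn.
  by exists (SeqSub yb).
rewrite -(card_seq_sub (l1ball_uniq n)) mulr_natl -sumr_const.
apply: ler_sum => y _; apply: phit_point_le_theta => //.
by rewrite leq_add2r -mem_l1ball (valP y).
Qed.

Lemma theta_cut s n a : is_law s ->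
  theta s (n + a) <= ((size (l1ball n))%:R * theta s n) * theta s a.
Proof.
move=> sl; rewrite [_ * theta s n]mulrC -mulrA.
apply: (@le_trans _ _ (phit s (l1ball (n + a)) [set 0] (sph n) *
   ((size (l1ball n))%:R * theta s a))).
  by apply: phit_cut; rewrite ?l1ball_uniq // => x ->; rewrite norm1_0.
apply: ler_wpM2r; first by rewrite mulr_ge0 ?theta_ge0.
by apply: phit_point_le_theta; rewrite ?l1ball_uniq ?norm1_0.
Qed.

(* If N(0) is contained in {v} and N(v) in {-v}, the path is trapped. *)
Lemma theta2_lt1 s : (0 < d)%N -> is_law s ->
  (forall A : {set Dir d}, A != finset.set0 -> A != [set: Dir d]%SET ->
     hit_prob s A < 1) -> theta s 2 < 1.
Proof.
move=> d0 sl Hs; pose v : Dir d := (Ordinal d0, true).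
pose v' : Dir d := (Ordinal d0, false).
have hitC (u : Dir d) : hit_prob s ([set~ u]%SET) < 1.
  have vv' : v != v' by rewrite /v /v' xpair_eqE andbF.
  apply: Hs; apply/negP => /eqP /finset.setP H.
    have := H (if u == v then v' else v); rewrite !inE.
    by case: (eqVneq u v) => [->|]; rewrite 1?eq_sym ?vv' // => /negbTE ->.
  by have := H u; rewrite !inE eqxx.
(* [S] lies in {u} with probability [1 - hit_prob s [set~ u]], and then [f S] loses at least [c]. *)
have step1 (f : {set Dir d} -> R) (u : Dir d) (c : R) : 0 <= c ->
    (forall S, f S <= 1) -> (forall S, S \subset [set u]%SET -> f S <= 1 - c) ->
    \sum_S s S * f S <= 1 - (1 - hit_prob s ([set~ u]%SET)) * c.
  move=> c0 f1 fu.
  rewrite -subr_ge0 addrAC compl_sum // hit_probE compl_sum // subr_ge0 mulr_suml.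
  apply: ler_sum => S _; rewrite -mulrA ler_wpM2l //; first by case: sl.
  case: eqP => /= SE; last by rewrite subrr mul0r subr_ge0.
  rewrite subr0 mul1r lerBrDr addrC -lerBrDr; apply: fu.
  apply/fintype.subsetP => w wS; apply/negPn/negP => wu.
  by have /finset.setP/(_ w) := SE; rewrite !inE wS; move: wu; rewrite inE => ->.
have v10 : norm1 (step (0 : site d) v) = 1%N.
  rewrite /norm1 (bigD1 (Ordinal d0)) //= big1; first by rewrite mxE eqxx /= mxE addn0.
  by move=> j /negbTE jd; rewrite !mxE jd addr0.
pose c := 1 - hit_prob s ([set~ v']%SET).
have c0 : 0 < c by rewrite subr_gt0.
apply: (@le_lt_trans _ _ (1 - (1 - hit_prob s ([set~ v]%SET)) * c)); last first.
  by rewrite ltrBlDr ltrDl mulr_gt0 // subr_gt0.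
rewrite /theta (@phit_step _ _ _ _ _ _ 0) ?l1ball_uniq ?mem_l1ball ?norm1_0 //.
apply: (step1) => [|S|S Sv]; [exact: ltW|exact: phit_le1|].
apply: (@le_trans _ _ (phit s (rem 0 (l1ball 2)) ([set 0] `|` [set step 0 v]) (sph 2))).
  apply: phit_mono => // x [->|[w wS ->]]; first by left.
  by right; move: (fintype.subsetP Sv _ wS); rewrite inE => /eqP ->.
rewrite (@phit_step _ _ _ _ _ _ (step 0 v)) ?rem_l1ball_uniq //; last 2 first.
- rewrite mem_rem_l1ball v10 andbT; apply/negP => /eqP vE.
  by move: v10; rewrite vE norm1_0.
- by right.
rewrite -[c]mulr1; apply: (step1) => // [S'|S' Sv']; first exact: phit_le1.
have Hx x : ([set 0] `|` [set step 0 v] `|` out (step 0 v) S') x ->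
    x = 0 \/ x = step 0 v.
  move=> [[|]|[w wS ->]]; [by left|by right|left].
  move: (fintype.subsetP Sv' _ wS); rewrite inE => /eqP ->.
  by rewrite -[RHS](step_back 0 v).
rewrite subrr phit_eq0 // => x /Hx[|] ->.
- by apply/negP => /mem_rem; rewrite mem_rem_l1ball eqxx.
- by rewrite mem_rem_uniqF ?rem_l1ball_uniq.
- by rewrite /sph /= norm1_0.
- by rewrite /sph /= v10.
Qed.

End Balls.

(** * From the random field to finite-volume sums *)

Section Bridge.
Context {R : realType} {d : nat}.

(** A step raises the norm by at most one, so the path meets the sphere of radius [n.+1]; before its
    first visit there it only uses sites of norm at most [n]. *)
Lemma reach_truncate (w w' : config d) n x y : (forall z, (norm1 z <= n)%N -> w' z = w z) ->
  (norm1 x <= n.+1)%N -> (n < norm1 y)%N -> reach w x y ->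
  exists2 y', reach w' x y' & norm1 y' = n.+1.
Proof.
move=> ww' xn yn xy; elim: xy xn yn => [z|z v t vz _ IH] zn tn.
  by exists z; [exact: reach_refl|apply/eqP; rewrite eqn_leq zn].
move: zn; rewrite leq_eqVlt => /orP[/eqP zn|zn].
  by exists z => //; exact: reach_refl.
have [|y' ty' y'n] := IH _ tn; first exact: leq_trans (norm1_step _ _) _.
by exists y' => //; apply: reach_step ty'; rewrite ww'.
Qed.

Lemma reaches_boundary_hits (w : config d) n :
  reaches_boundary w n <->
  hits (fun u => if u \in l1ball n.+1 then w u else finset.set0) [set 0] (sph n.+1).
Proof.
split=> [[y [xy yn]]|[x [y [-> yn xy]]]].
  have [|||y' xy' y'n] := @reach_truncate w
      (fun u => if u \in l1ball n.+1 then w u else finset.set0) n 0 y _ _ _ xy.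
  - by move=> z zn; rewrite mem_l1ball ltnW.
  - by rewrite norm1_0.
  - by rewrite yn.
  - by exists 0, y'.
exists y; split=> //; apply: reach_sub xy => z.
by case: ifP => // _; exact: finset.sub0set.
Qed.

Lemma measure_fin_cover (dT : measure_display) (T : measurableType dT)
    (P : {measure set T -> \bar R}) (I : finType) (E : set T) (F : I -> set T) :
  (forall i, measurable (F i)) -> (forall x, E x <-> exists i, F i x) ->
  (forall i j x, F i x -> F j x -> i = j) ->
  measurable E /\ P E = (\sum_i P (F i))%E.
Proof.
move=> mF EF dF.
have -> : E = \bigcup_(i in [set` index_enum I]) F i.
  apply/seteqP; split=> x; first by move=> /EF[i Fi]; exists i => //=; rewrite mem_index_enum.
  by move=> [i _ Fi]; apply/EF; exists i.
split; first by apply: fin_bigcup_measurable => //; exact: finite_seq.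
rewrite measure_fin_bigcup //; first by rewrite -fsbig_seq // index_enum_uniq.
by move=> i j _ _ [x [Fi Fj]]; exact: dF Fi Fj.
Qed.

(** Splitting by the value of [N a] moves [a] from the averaged list [W] to the pinned list [L];
    once [W] is empty, the product formula of [iid_field] applies. *)
Lemma iid_prob (p : {ffun {set Dir d} -> R}) (dT : measure_display)
    (T : measurableType dT) (P : probability T R) (N : site d -> T -> {set Dir d}) :
  iid_field P N p ->
  forall W L (w : config d) (g : config d -> Prop), uniq (W ++ L) ->
  let E := [set x | g (fun u => if u \in W then N u x else w u) /\
                    forall u, u \in L -> N u x = w u] in
  measurable E /\
  P E = (\prod_(u <- L) p (w u) * Ex p W w (fun w => `[< g w >]%:R))%:E.
Proof.
move=> [mN PN]; elim=> [|a W IH] L w g uWL E /=.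
  have mC : measurable [set x | forall u, u \in L -> N u x = w u].
    have -> : [set x | forall u, u \in L -> N u x = w u] =
        \bigcap_(u in [set` L]) [set x | N u x = w u] by [].
    by apply: fin_bigcap_measurable => // u _; exact: mN.
  case: (pselect (g w)) => gw.
    have -> : E = [set x | forall u, u \in L -> N u x = w u].
      by apply/seteqP; split=> x // [].
    by rewrite asboolT // mulr1 PN.
  have -> : E = set0 by apply/seteqP; split=> x // [].
  by rewrite asboolF // mulr0 measure0.
pose F S := [set x | g (fun u => if u \in W then N u x else upd w a S u) /\
                    forall u, u \in a :: L -> N u x = upd w a S u].
have uWL' : uniq (W ++ a :: L) by rewrite -(perm_uniq (permEl (perm_catCA [:: a] W L))).
have aWL : a \notin W ++ L by move: uWL => /= /andP[].
have aL : a \notin L by move: aWL; rewrite mem_cat negb_or => /andP[].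
have IHF S := IH (a :: L) (upd w a S) g uWL'.
have Fcfg S x : F S x -> (fun u => if u \in W then N u x else upd w a S u) =
    (fun u => if u \in a :: W then N u x else w u).
  move=> [_ Hx]; apply/funext => u; rewrite inE.
  case: (eqVneq u a) => [->|ua] /=; last by rewrite /upd (negbTE ua).
  by rewrite -Hx ?inE ?eqxx // if_same.
have FN S x : F S x -> N a x = S.
  by move=> [_ /(_ a)]; rewrite inE eqxx /upd eqxx; exact.
have [|x|S S' x FS FS'|mE ->] := @measure_fin_cover _ _ P _ E F.
- by move=> S; case: (IHF S).
- split=> [[gx Lx]|[S FSx]].
    exists (N a x).
    have aLx u : u \in a :: L -> N u x = upd w a (N a x) u.
      rewrite inE /upd; case: eqVneq => [->//|_ /= uL]; exact: Lx.
    split=> //; move: gx; congr g; apply/funext => u; rewrite inE /upd.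
    by case: (eqVneq u a) => [->|//]; rewrite if_same.
  split; first by have := Fcfg _ _ FSx; move: FSx => [gx _] <-.
  move=> u uL; move: FSx => [_ /(_ u)]; rewrite inE uL orbT => ->//.
  by rewrite /upd; case: eqVneq => // ua; rewrite -ua uL in aL.
- by rewrite -(FN _ _ FS) (FN _ _ FS').
split=> //; rewrite mulr_sumr -sumEFin; apply: eq_bigr => S _.
have [_ PF] := IHF S; rewrite [LHS]PF big_cons {1}/upd eqxx -mulrA mulrCA; congr (_%:E).
congr (_ * _); apply: eq_big_seq => u uL; rewrite /upd.
by case: eqVneq => // ua; rewrite -ua uL in aL.
Qed.

Lemma iid_theta (p : {ffun {set Dir d} -> R}) (dT : measure_display)
    (T : measurableType dT) (P : probability T R) (N : site d -> T -> {set Dir d}) n :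
  iid_field P N p ->
  measurable [set x | reaches_boundary (fun u => N u x) n] /\
  P [set x | reaches_boundary (fun u => N u x) n] = (theta p n.+1)%:E.
Proof.
move=> HN.
have := @iid_prob p _ _ P N HN (l1ball n.+1) [::] (@none d)
  (fun w => hits w [set 0] (sph n.+1)).
rewrite cats0 l1ball_uniq big_nil mul1r => /(_ isT) /=.
set E := [set x | _ /\ _]; suff -> : E = [set x | reaches_boundary (N^~ x) n] by [].
apply/seteqP; split=> x; first by move=> [/reaches_boundary_hits].
by move=> /reaches_boundary_hits.
Qed.

Lemma reaches_infinityP (w : config d) :
  reaches_infinity w <-> forall n, reaches_boundary w n.
Proof.
split=> [inf n|bd fin].
  apply: contrapT => nbd; apply: inf.
  apply: (@sub_finite_set _ _ [set` l1ball n]); last exact: finite_seq.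
  move=> y /= xy; rewrite mem_l1ball leqNgt; apply/negP => ny; apply: nbd.
  have [|y' xy' y'n] := @reach_truncate w w n 0 y (fun _ _ => erefl) _ ny xy.
    by rewrite norm1_0.
  by exists y'.
have /finite_seqP[l lE] := fin.
have [y [xy yn]] := bd (\max_(z <- l) norm1 z)%N.
have yl : y \in l by have : [set` l] y by rewrite -lE.
by have := @leq_bigmax_seq _ l xpredT (@norm1 d) y yl isT; rewrite yn ltnn.
Qed.

(** Continuity from above: the events of reaching the boundary of B_n decrease to that of an
    infinite cluster. *)
Lemma theta_cvg0 (q : {ffun {set Dir d} -> R}) (dT : measure_display)
    (T : measurableType dT) (Q : probability T R) (M : site d -> T -> {set Dir d})
    (e : R) : is_law q ->
  iid_field Q M q -> Q [set x | reaches_infinity (fun u => M u x)] = 0%E ->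
  0 < e -> exists n, theta q n < e.
Proof.
move=> ql HM Q0 e0.
pose F n := [set x | reaches_boundary (fun u => M u x) n].
have FE : [set x | reaches_infinity (fun u => M u x)] = \bigcap_n F n.
  apply/seteqP; split=> x; first by move=> /reaches_infinityP H n _; exact: H.
  by move=> H; apply/reaches_infinityP => n; exact: H.
have mF n : measurable (F n) by have [] := @iid_theta q _ _ Q M n HM.
have QF n : Q (F n) = (theta q n.+1)%:E by have [_ ->] := @iid_theta q _ _ Q M n HM.
have anti : {homo F : n m / (n <= m)%N >-> (n >= m)%O}.
  move=> n m nm; apply/subsetPset => x [y [xy ym]].
  have [||y' xy' y'n] := @reach_truncate (M^~ x) (M^~ x) n 0 y (fun _ _ => erefl) _ _ xy.
  - by rewrite norm1_0.
  - by rewrite ym ltnS.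
  - by exists y'.
have Q0' : Q (\bigcap_n F n) = 0%E by rewrite -FE.
have cv : (Q \o F) n @[n --> \oo] --> 0%E.
  rewrite -Q0'; apply: nonincreasing_cvg_mu => //.
    by rewrite [X in (X < _)%E]QF ltry.
  exact: bigcapT_measurable.
move/fine_cvgP : cv => [_ /cvgrPdist_lt/(_ e e0)[n _ /(_ n (leqnn n))]] /=.
by rewrite sub0r normrN QF /= ger0_norm ?theta_ge0 // => H; exists n.+1.
Qed.

End Bridge.

(** * Real analysis: decay from contraction and from submultiplicativity *)

Section Decay.
Context {R : realType}.

Lemma geometric_dominates_poly (d : nat) :
  exists j : nat, (2 / 3 : R) ^+ j * j.+1%:R ^+ d <= 2^-1.
Proof.
have bern (L : nat) : (2 / 3 : R) ^+ L * (1 + L%:R / 2) <= 1.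
  elim: L => [|L IH]; first by rewrite expr0 mul0r addr0 mulr1.
  apply: le_trans IH; rewrite exprSr -mulrA.
  apply: ler_wpM2l; first by rewrite exprn_ge0 //; lra.
  by rewrite -(natr1 L); have := ler0n R L; lra.
(* With x = 1 + L/2 <= (3/2)^L and j = L (d + 1), the choice of [c] gives j + 1 <= c x and that of
   [L] gives 2 c^d <= x. Hence (j + 1)^d <= x^(d+1) / 2 <= (3/2)^j / 2. *)
pose c : nat := (2 * d.+1)%N; pose L : nat := (4 * c ^ d)%N.
exists (L * d.+1)%N; pose x : R := 1 + L%:R / 2.
have x0 : 0 <= x by rewrite addr_ge0 // divr_ge0.
have jx : (L * d.+1).+1%:R <= c%:R * x.
  rewrite /x /c -(natr1 (L * _)) !natrM -(natr1 d); move: (ler0n R d) (ler0n R L); nra.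
have cx : 2 * c%:R ^+ d <= x.
  rewrite /x /L natrM natrX; have : 0 <= (c%:R : R) ^+ d by rewrite exprn_ge0.
  lra.
set y := (2 / 3 : R) ^+ _; have y0 : 0 <= y by rewrite exprn_ge0 //; lra.
have yx : y * x ^+ d.+1 <= 1.
  rewrite /y exprM -exprMn; apply: exprn_ile1; last exact: bern.
  by rewrite mulr_ge0 // exprn_ge0 //; lra.
have jd : (L * d.+1).+1%:R ^+ d <= c%:R ^+ d * x ^+ d.
  by rewrite -exprMn lerXn2r // nnegrE ?mulr_ge0.
have xd : 2 * c%:R ^+ d * (y * x ^+ d) <= x * (y * x ^+ d).
  by apply: ler_wpM2r => //; rewrite mulr_ge0 // exprn_ge0.
have yj : y * (L * d.+1).+1%:R ^+ d <= y * (c%:R ^+ d * x ^+ d).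
  exact: ler_wpM2l.
have -> : 2^-1 = 2^-1 * 1 :> R by rewrite mulr1.
apply: (le_trans yj); rewrite -ler_pdivrMl ?invr_gt0 // invrK.
apply: le_trans yx; rewrite [leLHS](_ : _ = 2 * c%:R ^+ d * (y * x ^+ d)); last by ring.
by apply: (le_trans xd); rewrite exprS mulrCA.
Qed.

Lemma half_pow_small (C : R) : exists i : nat, C * 2^-1 ^+ i <= 2^-1.
Proof.
pose i := Num.bound `|C|.
have iC : `|C| <= i%:R by apply: ltW; exact: archi_boundP.
exists i.+1; rewrite exprS mulrCA -[leRHS]mulr1 ler_wpM2l // ?invr_ge0 //.
rewrite exprVn ler_pdivrMr ?exprn_gt0 // mul1r.
apply: (le_trans (ler_norm C)); apply: (le_trans iC).
by rewrite -natrX ler_nat ltnW // ltn_expl.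
Qed.

(* The parameter decreases by at most kappa * tau at each of the j
   contractions that pass from m to (j + 1) m; since tau is multiplied by
   (2/3)^j every time, the total decrease is a convergent geometric series. *)
Lemma contraction_decay (d : nat) (kappa : R) (tau : R -> nat -> R) :
  0 <= kappa ->
  (forall t m, 0 <= t <= 1 -> 0 <= tau t m) ->
  (forall t t' m, 0 <= t' -> t' <= t -> t <= 1 -> (0 < m)%N -> tau t' m <= tau t m) ->
  (forall t t' k m, 0 <= t' -> t' <= t -> t <= 1 -> (0 < k)%N -> (0 < m)%N ->
     kappa * tau t m <= t - t' -> tau t k <= 2^-1 ->
     tau t' (k + m)%N <= 2 / 3 * tau t k) ->
  (forall e, 0 < e -> exists2 m, (0 < m)%N & tau 1 m < e) ->
  exists2 n, (0 < n)%N & n.*2.+1%:R ^+ d * tau 0 n <= 2^-1.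
Proof.
move=> k0 tau0 tauM tauC tauS.
have block (t a : R) m i : (0 < m)%N -> 0 <= a -> a <= 2^-1 -> t <= 1 ->
    0 <= t - i%:R * (kappa * a) ->
    tau t m <= a -> tau (t - i%:R * (kappa * a)) (i.+1 * m)%N <= (2 / 3) ^+ i * a.
  move=> m0 a0 a2 t1; elim: i => [|i IH]; first by rewrite mul0r subr0 mul1n mul1r.
  move=> ti ta; set t' := t - i%:R * (kappa * a) in IH.
  have ka : 0 <= kappa * a by rewrite mulr_ge0.
  have tiE : t - i.+1%:R * (kappa * a) = t' - kappa * a.
    by rewrite /t' -natr1 mulrDl mul1r opprD addrA.
  rewrite tiE in ti *.
  have t't : t' <= t by rewrite /t' lerBlDr lerDl mulr_ge0.
  have t'0 : 0 <= t' by lra.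
  have {}IH := IH t'0 ta.
  have c1 : (2 / 3 : R) ^+ i <= 1 by rewrite exprn_ile1 //; lra.
  rewrite mulSn addnC exprS -mulrA.
  apply: (@le_trans _ _ (2 / 3 * tau t' (i.+1 * m)%N)); last first.
    by rewrite ler_wpM2l //; lra.
  apply: tauC => //; [lra|exact: le_trans t1|by rewrite muln_gt0| |].
  - rewrite subKr ler_wpM2l //; apply: le_trans ta; exact: tauM.
  - by apply: (le_trans IH); apply: le_trans a2; rewrite ler_piMl.
have [j Hj] := geometric_dominates_poly d.
pose b : R := (2 / 3) ^+ j.
have b0 : 0 <= b by rewrite exprn_ge0 //; lra.
have b2 : b <= 2^-1.
  apply: le_trans Hj; rewrite ler_peMr // exprn_ege1 // ler1n //.
have K0 : 0 <= j%:R * kappa :> R by rewrite mulr_ge0.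
(* The total loss of parameter will be at most 2 j kappa a, so this bound keeps the parameter
   nonnegative. *)
have [a [a0 a2 Ka]] : exists a : R, [/\ 0 < a, a <= 2^-1 & 2 * (j%:R * kappa * a) <= 1].
  exists (2 + 2 * (j%:R * kappa))^-1; split.
  - by rewrite invr_gt0; lra.
  - by rewrite lef_pV2 ?posrE; lra.
  - by rewrite !mulrA ler_pdivrMr; lra.
have [m0 m00 m0a] := tauS a a0.
(* T_i - T_(i+1) = j kappa a / 2^i pays for the j contractions of stage i, as the current bound b^i
   a is at most a / 2^i. *)
pose T i : R := 1 - 2 * (j%:R * kappa * a) * (1 - 2^-1 ^+ i).
have p2 i : 0 <= (2^-1 : R) ^+ i <= 1.
  by rewrite exprn_ge0 ?exprn_ile1 //; lra.
have T01 i : 0 <= T i <= 1.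
  have /andP[h0 h1] := p2 i; rewrite /T.
  have : 0 <= 2 * (j%:R * kappa * a) by rewrite !mulr_ge0 // ltW.
  move: (2 * (j%:R * kappa * a)) Ka => z; move: (2^-1 ^+ i) h0 h1 => h; nra.
have main i : tau (T i) (j.+1 ^ i * m0)%N <= b ^+ i * a.
  elim: i => [|i IH].
    by rewrite /T !expr0 subrr mulr0 subr0 mul1n mul1r ltW.
  have /andP[Ti0 Ti1] := T01 i; have /andP[TSi0 TSi1] := T01 i.+1.
  have bi : 0 <= b ^+ i <= 2^-1 ^+ i.
    by rewrite exprn_ge0 //= lerXn2r // nnegrE; lra.
  have TS : T i.+1 <= T i - j%:R * (kappa * (b ^+ i * a)).
    rewrite /T exprS [in leRHS](_ : j%:R * (kappa * _) = j%:R * kappa * a * b ^+ i);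
      last by rewrite [b ^+ i * a]mulrC !mulrA.
    have Kaa : 0 <= j%:R * kappa * a by rewrite mulr_ge0 // ltW.
    move/andP: bi => [_ bi]; have := ler_wpM2l Kaa bi.
    by move: (j%:R * kappa * a) (b ^+ i) => z h; lra.
  have bia0 : 0 <= b ^+ i * a by rewrite mulr_ge0 ?exprn_ge0 // ltW.
  have bia : b ^+ i * a <= 2^-1.
    have /andP[_ p21] := p2 i; apply: le_trans a2; rewrite ler_piMl //; first exact: ltW.
    by move/andP: bi => [_ bi]; apply: (le_trans bi).
  have := @block (T i) (b ^+ i * a) (j.+1 ^ i * m0)%N j.
  rewrite muln_gt0 expn_gt0 m00 mulnA -expnS -/b [b * _]mulrA -exprS => H.
  apply: (le_trans (tauM _ _ _ TSi0 TS _ _)); [|by rewrite muln_gt0 expn_gt0|].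
    apply: le_trans Ti1; rewrite lerBlDr lerDl.
    exact: mulr_ge0 (mulr_ge0 k0 bia0).
  apply: H => //.
  exact: le_trans TS.
(* At n = (j + 1)^i m0 the volume factor is at most (3 m0)^d (j + 1)^(i d); since b (j + 1)^d <=
   1/2, the product is at most (3 m0)^d a / 2^i. *)
have [i Hi] := half_pow_small ((3 * m0)%:R ^+ d * a).
exists (j.+1 ^ i * m0)%N; first by rewrite muln_gt0 expn_gt0.
have n3 : (j.+1 ^ i * m0).*2.+1%:R <= (3 * m0)%:R * j.+1%:R ^+ i :> R.
  rewrite -natrX -natrM ler_nat; have : (0 < j.+1 ^ i * m0)%N by rewrite muln_gt0 expn_gt0.
  by rewrite -mulnA [(m0 * _)%N]mulnC; lia.
apply: le_trans Hi.
have t0 : tau 0 (j.+1 ^ i * m0)%N <= b ^+ i * a.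
  have /andP[Ti0 Ti1] := T01 i; apply: le_trans (main i); apply: tauM => //.
  by rewrite muln_gt0 expn_gt0.
apply: (@le_trans _ _ (((3 * m0)%:R * j.+1%:R ^+ i) ^+ d * (b ^+ i * a))).
  apply: ler_pM => //; rewrite ?exprn_ge0 ?tau0 ?lexx //=.
  by rewrite lerXn2r // nnegrE // mulr_ge0 // exprn_ge0.
rewrite exprMn exprAC [leLHS](_ : _ = (3 * m0)%:R ^+ d * a * (b * j.+1%:R ^+ d) ^+ i).
  apply: ler_wpM2l; first by rewrite mulr_ge0 ?exprn_ge0 // ltW.
  by rewrite lerXn2r // nnegrE ?mulr_ge0 // ?exprn_ge0 // invr_ge0.
by rewrite exprMn; ring.
Qed.

(** Each block of length [n] gains a factor 1/2. For 0 < m < n the bound rests on [f 2 < 1], and for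
    m = 0 on [f <= 1]. *)
Lemma submultiplicative_decay (f : nat -> R) (n : nat) : (0 < n)%N ->
  (forall m, 0 <= f m) -> (forall m, f m <= 1) ->
  (forall m m', (m <= m')%N -> f m' <= f m) -> f 2 < 1 ->
  (forall m, f (n + m)%N <= 2^-1 * f m) ->
  exists2 c : R, 0 < c & forall m, f m.+1 <= expR (- (c * m%:R)).
Proof.
move=> n0 f0 f1 fanti f2 fn.
pose rho := Num.max (f 2) (2^-1 : R).
have rho0 : 0 < rho by rewrite lt_max invr_gt0 ltr0n orbT.
have rho1 : rho < 1 by rewrite gt_max f2 /=; lra.
have fq q m : f (q * n + m)%N <= rho ^+ q.
  elim: q => [|q IH]; first by rewrite expr0.
  rewrite mulSn -addnA exprS; apply: (le_trans (fn _)).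
  by apply: ler_pM; rewrite ?invr_ge0 // le_max lexx orbT.
have lnr : 0 < - ln rho by rewrite oppr_gt0 ln_lt0 // rho0.
(* The 2 in the rate absorbs rounding: m <= 2 n (m %/ n) as soon as n <= m. *)
exists (- ln rho / (2 * n)%:R); first by rewrite divr_gt0 // ltr0n muln_gt0.
have bound q m : (m <= 2 * n * q)%N -> f m.+1 <= rho ^+ q ->
    f m.+1 <= expR (- (- ln rho / (2 * n)%:R * m%:R)).
  move=> mq fm; apply: (le_trans fm).
  rewrite -[X in X ^+ _]lnK ?posrE // -expRM_natl ler_expR.
  rewrite -[leLHS]opprK lerN2 -mulrN -mulrA mulrC ler_wpM2r //; first exact: ltW.
  by rewrite mulrC ler_pdivrMr ?ltr0n ?muln_gt0 // -natrM ler_nat mulnC.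
move=> m; have [->|m0] := posnP m; first by rewrite mulr0 oppr0 expR0.
have [mn|nm] := ltnP m n.
  apply: (@bound 1%N); first by lia.
  by rewrite expr1 le_max fanti.
apply: (@bound (m %/ n)%N).
  have := ltn_ceil m n0; have : (0 < m %/ n)%N by rewrite divn_gt0.
  by nia.
by rewrite {1}(divn_eq m n) -addnS fq.
Qed.

End Decay.

(** * Interpolation between the two laws and conclusion *)

Definition interp (R : realType) (d : nat) (p q : {ffun {set Dir d} -> R}) (t : R) :
  {ffun {set Dir d} -> R} := [ffun S => (1 - t) * p S + t * q S].

Lemma interp_law (R : realType) (d : nat) (p q : {ffun {set Dir d} -> R}) (t : R) :
  is_law p -> is_law q -> 0 <= t <= 1 -> is_law (interp p q t).
Proof.
move=> [p0 p1] [q0 q1] /andP[t0 t1]; split=> [S|].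
  by rewrite ffunE addr_ge0 // mulr_ge0 // subr_ge0.
under eq_bigr => S _ do rewrite ffunE.
by rewrite big_split /= -!mulr_sumr p1 q1 !mulr1 subrK.
Qed.

Lemma hit_interp (R : realType) (d : nat) (p q : {ffun {set Dir d} -> R}) (t : R) A :
  hit_prob (interp p q t) A = (1 - t) * hit_prob p A + t * hit_prob q A.
Proof.
rewrite /hit_prob !mulr_sumr -big_split /=.
by apply: eq_bigr => S _; rewrite ffunE.
Qed.

Lemma hit_prob_le1 (R : realType) (d : nat) (p : {ffun {set Dir d} -> R}) A :
  is_law p -> hit_prob p A <= 1.
Proof.
move=> [p0 <-]; rewrite /hit_prob [leRHS](bigID (fun S => S :&: A != finset.set0)) /=.
by rewrite lerDl sumr_ge0.
Qed.

Theorem theorem2p3 (R : realType) (d : nat) (hd : (0 < d)%N)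
  (p q : {ffun {set Dir d} -> R}) (hp : is_law p) (hq : is_law q)
  (hpq : forall A : {set Dir d}, A != finset.set0 -> A != [set: Dir d]%SET ->
           hit_prob p A < hit_prob q A)
  (dT : measure_display) (T : measurableType dT) (P : probability T R)
  (N : site d -> T -> {set Dir d}) (hN : iid_field P N p)
  (dU : measure_display) (U : measurableType dU) (Q : probability U R)
  (M : site d -> U -> {set Dir d}) (hM : iid_field Q M q)
  (hQ : Q [set w | reaches_infinity (fun u => M u w)] = 0%E) :
  exists c : R, 0 < c /\
    forall n : nat,
      (P [set w | reaches_boundary (fun u => N u w) n]
        <= (expR (- (c * n%:R)))%:E)%E.
Proof.
pose proper (A : {set Dir d}) := (A != finset.set0) && (A != [set: Dir d]%SET).
(* There are finitely many [A], so the strict inequalities have a common gap; the default value 1 is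
   positive as well. *)
pose eta : R := \big[Num.min/1]_(A | proper A) (hit_prob q A - hit_prob p A).
have eta0 : 0 < eta.
  by apply: lt_bigmin => // A /andP[A0 AT]; rewrite subr_gt0 hpq.
have Heta A : A != finset.set0 -> A != [set: Dir d]%SET ->
    eta <= hit_prob q A - hit_prob p A.
  by move=> A0 AT; apply: (@bigmin_le_cond _ _ _ _ A proper); rewrite /proper A0.
pose D : R := #|{: Dir d}|%:R.
pose ta t m := tau (interp p q t) m.
have lawt t : 0 <= t <= 1 -> is_law (interp p q t) by exact: interp_law.
have Hhit t t' (e : R) A : 0 <= t' -> t' <= t -> t <= 1 ->
    0 <= e -> e <= (t - t') * eta ->
    A != finset.set0 -> A != [set: Dir d]%SET ->
    hit_prob (interp p q t') A <= (1 - e) * hit_prob (interp p q t) A.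
  move=> t'0 t't t1 e0 ett A0 AT.
  have t01 : 0 <= t <= 1 by rewrite t1 (le_trans t'0).
  have h1 := @hit_prob_le1 _ _ _ A (lawt _ t01).
  have /(ler_wpM2l _) gap := Heta A A0 AT.
  have {}gap : (t - t') * eta <= (t - t') * (hit_prob q A - hit_prob p A).
    by apply: gap; rewrite subr_ge0.
  have eh := ler_wpM2l e0 h1; rewrite mulr1 in eh.
  rewrite mulrBl mul1r; move: eh; rewrite !hit_interp; lra.
have [n n0 Hn] : exists2 n, (0 < n)%N & n.*2.+1%:R ^+ d * ta 0 n <= 2^-1.
  (* This constant turns the loss condition of the contraction into D theta <= (t - t') eta, because
     theta <= tau. *)
  apply: (@contraction_decay R d (D / eta) ta).
  - by rewrite divr_ge0 // ltW.
  - by move=> t m /lawt; exact: tau_ge0.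
  - move=> t t' m t'0 t't t1 m0; apply: le_tau => //.
    + by apply: lawt; rewrite t'0 (le_trans t't).
    + by apply: lawt; rewrite t1 (le_trans t'0).
    + move=> A A0 AT; rewrite -[leRHS]mul1r -[X in X * _]subr0.
      by apply: Hhit => //; rewrite mulr_ge0 ?subr_ge0 // ltW.
  - move=> t t' k m t'0 t't t1 k0 m0 gap tk.
    have lt : is_law (interp p q t) by apply: lawt; rewrite t1 (le_trans t'0).
    apply: tau_contract => //; first by apply: lawt; rewrite t'0 (le_trans t't).
    move=> A A0 AT; apply: Hhit => //; first by rewrite mulr_ge0 // theta_ge0.
    rewrite -ler_pdivrMr //; apply: le_trans gap; rewrite mulrAC.
    by rewrite ler_wpM2l ?theta_le_tau // divr_ge0 // ltW.
  - move=> e e0; have D1 : 0 < (#|{: Dir d}|.+1%:R : R) by [].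
    have [m Hm] := @theta_cvg0 _ _ q _ _ Q M _ hq hM hQ (divr_gt0 e0 D1).
    exists m.+1 => //; rewrite /ta (_ : interp p q 1 = q).
      by apply: (le_lt_trans (tau_le_theta m hq)); rewrite mulrC -ltr_pdivlMr.
    by apply/ffunP => S; rewrite ffunE subrr mul0r add0r mul1r.
have pE : interp p q 0 = p.
  by apply/ffunP => S; rewrite ffunE subr0 mul0r addr0 mul1r.
rewrite /ta pE in Hn.
have [|||||c c0 Hc] := @submultiplicative_decay R (theta p) n n0.
- by move=> m; exact: theta_ge0.
- by move=> m; exact: theta_le1.
- by move=> m m'; exact: theta_anti.
- apply: theta2_lt1 => // A A0 AT.
  exact: lt_le_trans (hpq _ A0 AT) (hit_prob_le1 _ hq).
(* The ball has at most (2n + 1)^d sites, so [Hn] makes the finite-size factor at most 1/2. *)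
- move=> m; apply: (le_trans (theta_cut n m hp)).
  rewrite ler_wpM2r ?theta_ge0 //; apply: le_trans Hn.
  apply: ler_pM; rewrite ?theta_ge0 // ?theta_le_tau // -natrX ler_nat.
  exact: size_l1ball.
exists c; split=> // m.
have [_ ->] := @iid_theta _ _ p _ _ P N m hN.
by rewrite lee_fin.
Qed.
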